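(* Consider the fourth-order ODE for a scalar function $\mathsf s$ of a real variable $u$, with $\mathsf s_i:=\mathsf s^{(i)}$, $\mathsf s_0=\mathsf s$, $$(\mathsf s_1^2-\mathsf s_0\mathsf s_2)\mathsf s_4+\mathsf s_0\mathsf s_3^2-2\mathsf s_1\mathsf s_2\mathsf s_3+\mathsf s_2^3=0\qquad(\ast)$$ with initial conditions $\mathsf s_i(u_0)=s_i$ for $0\le i\le 3$, where $u_0\in\mathbb R$, $s_1\ne0$ and $s_1^2-s_0s_2\neq0$. Define $$S:=\frac{\mathsf s_1\mathsf s_2-\mathsf s\,\mathsf s_3}{\mathsf s_1^2-\mathsf s\,\mathsf s_2},\qquad P:=\frac{\mathsf s_2^2-\mathsf s_3\mathsf s_1}{\mathsf s_1^2-\mathsf s\,\mathsf s_2}.$$ If $\mathsf s$ is a solution of $(\ast)$ (with these initial conditions, on an interval containing $u_0$), then $S$ and $P$ are constants, and $\mathsf s$ also satisfies $$\mathsf s_2-S\,\mathsf s_1+P\,\mathsf s=0 .$$ Thus $(\ast)$ with the given initial conditions has a unique solution in an interval containing $u_0$, and it is of one of the following forms, depending on $\Delta:=S(u_0)^2-4P(u_0)$: 1. if $\Delta>0$: $\mathsf s(u)=p_0e^{p_1u}+p_2e^{p_3u}$ with $p_0p_2(p_1-p_3)\ne0$, $p_3>p_1$; 2. if $\Delta=0$: $\mathsf s(u)=(a_0+a_1u)e^{a_2u}$ with $a_1\ne0$; 3. if $\Delta<0$: $\mathsf s(u)=b_0e^{b_1u}\sin(b_2u+b_3)$ with $b_0>0$,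 $b_2>0$. In case 1, $p_1$ and $p_3$ are the roots of $z^2-S(u_0)z+P(u_0)$; in case 3, $b_1\pm\sqrt{-1}\,b_2$ are the roots of the same polynomial; in case 2, $a_2=S/2$. The remaining coefficients can be determined (from the initial conditions) once these roots are found.
   Context: All functions and parameters are real-valued. $S(u_0)$ and $P(u_0)$ are the values of $S$ and $P$ computed from the initial data $s_0,s_1,s_2,s_3$. *)

(* Defs.v *)
(* Stdlib real numbers with Coquelicot *)
From Stdlib Require Import Reals ZArith.
From Coquelicot Require Import Coquelicot.
Open Scope R_scope.

(* The open interval with possibly infinite ends a and b. *)
Definition in_itv (a b : Rbar) (u : R) : Prop := Rbar_lt a u /\ Rbar_lt u b.

Definition D_of (x0 x1 x2 : R) : R := x1 ^ 2 - x0 * x2.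

Definition S_of (x0 x1 x2 x3 : R) : R := (x1 * x2 - x0 * x3) / D_of x0 x1 x2.

Definition P_of (x0 x1 x2 x3 : R) : R := (x2 ^ 2 - x3 * x1) / D_of x0 x1 x2.

Definition Dfun (s : R -> R) (u : R) : R :=
  D_of (s u) (Derive_n s 1 u) (Derive_n s 2 u).

Definition Sfun (s : R -> R) (u : R) : R :=
  S_of (s u) (Derive_n s 1 u) (Derive_n s 2 u) (Derive_n s 3 u).

Definition Pfun (s : R -> R) (u : R) : R :=
  P_of (s u) (Derive_n s 1 u) (Derive_n s 2 u) (Derive_n s 3 u).

Definition ode_at (s : R -> R) (u : R) : Prop :=
  let s0 := s u in
  let s1 := Derive_n s 1 u in
  let s2 := Derive_n s 2 u in
  let s3 := Derive_n s 3 u in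
  let s4 := Derive_n s 4 u in
  (s1 ^ 2 - s0 * s2) * s4 + s0 * s3 ^ 2 - 2 * s1 * s2 * s3 + s2 ^ 3 = 0.

(* [ex_derive_n s 4 u] alone only asserts that the total function
   [Derive_n s 3] is differentiable at [u], hence the quantifier over the
   orders up to 4. *)
Definition solution_on (a b : Rbar) (s : R -> R) : Prop :=
  forall u : R, in_itv a b u ->
    (forall k : nat, (k <= 4)%nat -> ex_derive_n s k u) /\ ode_at s u.

Definition init_cond (u0 s0 s1 s2 s3 : R) (s : R -> R) : Prop :=
  s u0 = s0 /\ Derive_n s 1 u0 = s1 /\ Derive_n s 2 u0 = s2 /\
  Derive_n s 3 u0 = s3.

Definition ivp_solution (a b : Rbar) (u0 s0 s1 s2 s3 : R) (s : R -> R) : Prop :=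
  solution_on a b s /\ init_cond u0 s0 s1 s2 s3 s.

(* z1 and z2 are exactly the complex roots of z^2 - S z + P. *)
Definition roots_are (Sv Pv : R) (z1 z2 : C) : Prop :=
  forall z : C,
    (z * z - RtoC Sv * z + RtoC Pv = RtoC 0)%C <-> z = z1 \/ z = z2.

Definition form_exp (p0 p1 p2 p3 : R) (u : R) : R :=
  p0 * exp (p1 * u) + p2 * exp (p3 * u).

Definition form_lin (a0 a1 a2 : R) (u : R) : R :=
  (a0 + a1 * u) * exp (a2 * u).

Definition form_sin (b0 b1 b2 b3 : R) (u : R) : R :=
  b0 * exp (b1 * u) * sin (b2 * u + b3).

(* Main.v *)
(** With [D = s1^2 - s0 s2] one has [D' = s1 s2 - s0 s3 = S D], and the
    numerators of the derivatives of [S] and [P] are multiples of the left-hand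
    side of the equation, so [S] and [P] are locally constant where [D <> 0].
    There [D] is a constant multiple of an exponential, hence it cannot reach 0
    and all this holds on the whole interval.  By the definitions of [S] and
    [P], [s2 - S s1 + P s = 0] identically; conversely every solution of this
    linear equation with constant coefficients satisfies the fourth-order one.
    The rest is the linear theory, where uniqueness comes from an explicit
    formula in terms of a fundamental solution. *)

Require Import Defs.
From Stdlib Require Import Reals ZArith Lra Lia.
From Coquelicot Require Import Coquelicot.
Open Scope R_scope.

(** * Calculus on intervals and segments *)

Lemma in_itv_between (a b : Rbar) (x y z : R) :
  in_itv a b x -> in_itv a b y -> Rmin x y <= z <= Rmax x y -> in_itv a b z.
Proof.
  unfold in_itv, Rmin, Rmax.
  destruct a as [a| |], b as [b| |], (Rle_dec x y); simpl; lra.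
Qed.

Lemma null_derivative_const (f : R -> R) (x y : R) :
  (forall z, Rmin x y < z < Rmax x y -> is_derive f z 0) ->
  (forall z, Rmin x y <= z <= Rmax x y -> continuous f z) ->
  f x = f y.
Proof.
  intros Hd Hc.
  destruct (MVT_gen f x y (fun _ => 0)) as [c [_ Hfc]].
  - exact Hd.
  - intros z Hz. apply continuity_pt_filterlim, Hc, Hz.
  - lra.
Qed.

Lemma null_derivative_const_itv (a b : Rbar) (f : R -> R) (x y : R) :
  in_itv a b x -> in_itv a b y ->
  (forall z, in_itv a b z -> is_derive f z 0) -> f x = f y.
Proof.
  intros Hx Hy Hd; apply null_derivative_const.
  - intros z Hz. apply Hd, (in_itv_between a b x y z Hx Hy). lra.
  - intros z Hz. apply (ex_derive_continuous f z). exists 0.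
    exact (Hd z (in_itv_between a b x y z Hx Hy Hz)).
Qed.

(* The eta-expanded form is the one that [auto_derive] leaves. *)
Lemma Derive_eta (f : R -> R) (x l : R) :
  is_derive f x l -> Derive (fun t => f t) x = l.
Proof. exact (is_derive_unique f x l). Qed.

(** Real induction along the segment from [x] to [y], in either direction. *)
Lemma segment_nonzero (g : R -> R) (x y : R) :
  (forall z, Rmin x y <= z <= Rmax x y -> continuous g z) ->
  (forall z, Rmin x y <= z <= Rmax x y ->
     (forall w, Rmin x z <= w <= Rmax x z -> w <> z -> g w <> 0) ->
     g z <> 0) ->
  g y <> 0.
Proof.
  intros Hc Hstep.
  (* Parametrizing the segment by [0, 1] treats [x <= y] and [y <= x] alike; the supremum argument
     then runs on the parameter. *)
  set (p := fun t => x + t * (y - x)).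
  assert (Hp : forall t, 0 <= t <= 1 -> Rmin x y <= p t <= Rmax x y).
  { intros t Ht. unfold p, Rmin, Rmax. destruct (Rle_dec x y); nra. }
  set (E := fun t => 0 <= t <= 1 /\ forall r, 0 <= r <= t -> g (p r) <> 0).
  assert (Hwx : forall t w, 0 <= t -> Rmin x (p t) <= w <= Rmax x (p t) ->
                  w <> p t -> exists r, 0 <= r < t /\ w = p r).
  { intros t w Ht Hw Hne.
    assert (Hyx : y - x <> 0).
    { intro H0. apply Hne. unfold p in *. rewrite H0 in *.
      revert Hw. unfold Rmin, Rmax. destruct (Rle_dec x (x + t * 0)); lra. }
    exists ((w - x) / (y - x)).
    assert (Hw' : w = p ((w - x) / (y - x))) by (unfold p; field; exact Hyx).
    split; [|exact Hw'].
    set (r := (w - x) / (y - x)) in *. clearbody r. subst w.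
    assert (Hrt : r <> t) by (intro; subst; apply Hne; reflexivity).
    revert Hw. unfold p, Rmin, Rmax.
    destruct (Rle_dec x (x + t * (y - x))), (Rtotal_order (y - x) 0)
      as [H|[H|H]]; intro Hw; try lra; split; nra. }
  assert (Hstep' : forall t, 0 <= t <= 1 ->
            (forall r, 0 <= r < t -> g (p r) <> 0) -> g (p t) <> 0).
  { intros t Ht Hr. apply Hstep; [exact (Hp t Ht)|].
    intros w Hw Hne. destruct (Hwx t w (proj1 Ht) Hw Hne) as [r [Hr' ->]].
    exact (Hr r Hr'). }
  assert (E0 : E 0).
  { split; [lra|]. intros r Hr. apply Hstep'; [lra|]. intros; lra. }
  destruct (completeness E) as [T [HT1 HT2]].
  { exists 1. intros t [Ht _]. lra. }
  { exists 0. exact E0. }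
  assert (HT : 0 <= T <= 1).
  { split; [exact (HT1 0 E0)|]. apply HT2. intros t [Ht _]. lra. }
  assert (Hlow : forall r, 0 <= r < T -> g (p r) <> 0).
  { intros r Hr Hgr. apply (Rlt_not_le T r); [lra|]. apply HT2.
    intros t [Ht Het]. destruct (Rle_or_lt t r) as [H|H]; [exact H|].
    exfalso. apply (Het r); [lra|exact Hgr]. }
  assert (HgT : g (p T) <> 0) by (apply Hstep'; assumption).
  destruct (Req_dec T 1) as [->|HT1'].
  { replace y with (p 1) by (unfold p; ring). exact HgT. }
  (* If [T < 1], continuity keeps [g (p t)] nonzero slightly beyond [T], against [T] being an upper
     bound of [E]. *)
  exfalso.
  assert (Hcont : continuous (fun t => g (p t)) T).
  { apply (continuous_comp p g).
    - apply (ex_derive_continuous p T). unfold p. auto_derive. exact I.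
    - exact (Hc _ (Hp T HT)). }
  assert (Hloc : locally T (fun t => g (p t) <> 0)).
  { apply (Hcont (fun z => z <> 0)). exists (mkposreal _ (Rabs_pos_lt _ HgT)).
    intros z Hz Hz0. subst z.
    revert Hz. unfold ball; simpl. unfold AbsRing_ball, abs, minus, plus, opp.
    simpl. rewrite Rplus_0_l, Rabs_Ropp. apply Rlt_irrefl. }
  destruct Hloc as [eps Heps].
  (* Half of [eps] puts the closed range up to [T + d] inside the open ball; the bound [1 - T] keeps
     it in the parameter range. *)
  set (d := Rmin (eps / 2) (1 - T)).
  assert (Hd : 0 < d <= eps / 2 /\ d <= 1 - T).
  { generalize (cond_pos eps). unfold d, Rmin.
    destruct (Rle_dec (eps / 2) (1 - T)); lra. }
  apply (Rlt_not_le (T + d) T); [lra|]. apply HT1. split; [lra|].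
  intros r Hr. destruct (Rlt_or_le r T) as [H|H]; [apply Hlow; lra|].
  apply Heps. unfold ball; simpl. unfold AbsRing_ball, abs, minus, plus, opp.
  simpl. apply Rabs_def1; generalize (cond_pos eps); lra.
Qed.

(** * Constancy of S and P along a solution *)

Lemma solution_derivatives (a b : Rbar) (s : R -> R) (u : R) (k : nat) :
  solution_on a b s -> in_itv a b u -> (k <= 3)%nat ->
  is_derive (Derive_n s k) u (Derive_n s (S k) u).
Proof.
  intros Hs Hu Hk. apply Derive_correct.
  apply (proj1 (Hs u Hu) (S k)). lia.
Qed.

Lemma Dfun_derive (a b : Rbar) (s : R -> R) (u : R) :
  solution_on a b s -> in_itv a b u ->
  is_derive (Dfun s) u
    (Derive_n s 1 u * Derive_n s 2 u - s u * Derive_n s 3 u).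
Proof.
  intros Hs Hu.
  pose proof (solution_derivatives a b s u 0 Hs Hu ltac:(lia)) as H0.
  pose proof (solution_derivatives a b s u 1 Hs Hu ltac:(lia)) as H1.
  pose proof (solution_derivatives a b s u 2 Hs Hu ltac:(lia)) as H2.
  change (is_derive s u (Derive_n s 1 u)) in H0.
  unfold Dfun, D_of.
  set (s1 := Derive_n s 1) in *. set (s2 := Derive_n s 2) in *.
  set (s3 := Derive_n s 3) in *. clearbody s1 s2 s3.
  auto_derive.
  - repeat split; try (eexists; eassumption).
  - rewrite (Derive_eta _ _ _ H0), (Derive_eta _ _ _ H1),
      (Derive_eta _ _ _ H2). ring.
Qed.

Lemma Sfun_Pfun_derive (a b : Rbar) (s : R -> R) (u : R) :
  solution_on a b s -> in_itv a b u -> Dfun s u <> 0 ->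
  is_derive (Sfun s) u 0 /\ is_derive (Pfun s) u 0.
Proof.
  intros Hs Hu HD.
  pose proof (solution_derivatives a b s u 0 Hs Hu ltac:(lia)) as H0.
  pose proof (solution_derivatives a b s u 1 Hs Hu ltac:(lia)) as H1.
  pose proof (solution_derivatives a b s u 2 Hs Hu ltac:(lia)) as H2.
  pose proof (solution_derivatives a b s u 3 Hs Hu ltac:(lia)) as H3.
  change (is_derive s u (Derive_n s 1 u)) in H0.
  pose proof (proj2 (Hs u Hu)) as Hode.
  unfold Sfun, Pfun, Dfun, S_of, P_of, D_of, ode_at in *.
  set (s1 := Derive_n s 1) in *. set (s2 := Derive_n s 2) in *.
  set (s3 := Derive_n s 3) in *. set (s4 := Derive_n s 4) in *.
  clearbody s1 s2 s3 s4. cbv zeta in Hode.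
  (* The coefficient of the fourth derivative in the equation is D, so the equation can be solved
     for it; both derivatives then vanish as rational identities. *)
  assert (E4 : s4 u = - (s u * s3 u ^ 2 - 2 * s1 u * s2 u * s3 u + s2 u ^ 3)
                      / (s1 u ^ 2 - s u * s2 u)).
  { apply (Rmult_eq_reg_l (s1 u ^ 2 - s u * s2 u)); [|exact HD].
    field_simplify; [lra|exact HD]. }
  split; auto_derive;
    try (repeat split; try (eexists; eassumption); simpl in *;
         intro; apply HD; lra);
    rewrite (Derive_eta _ _ _ H0), (Derive_eta _ _ _ H1),
      (Derive_eta _ _ _ H2), (Derive_eta _ _ _ H3), E4;
    field; intro; apply HD; lra.
Qed.

Lemma solution_invariants (a b : Rbar) (s : R -> R) (u0 : R) :
  in_itv a b u0 -> solution_on a b s -> Dfun s u0 <> 0 ->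
  forall u, in_itv a b u ->
    Dfun s u <> 0 /\ Sfun s u = Sfun s u0 /\ Pfun s u = Pfun s u0.
Proof.
  intros Hu0 Hs HD0.
  assert (Hcont : forall z, in_itv a b z -> continuous (Dfun s) z).
  { intros z Hz. apply (ex_derive_continuous (Dfun s) z). eexists.
    exact (Dfun_derive a b s z Hs Hz). }
  assert (HSP : forall v, in_itv a b v ->
            (forall z, Rmin u0 v <= z <= Rmax u0 v -> Dfun s z <> 0) ->
            Sfun s v = Sfun s u0 /\ Pfun s v = Pfun s u0).
  { intros v Hv HD.
    assert (Hd : forall z, Rmin u0 v <= z <= Rmax u0 v ->
              is_derive (Sfun s) z 0 /\ is_derive (Pfun s) z 0).
    { intros z Hz. apply (Sfun_Pfun_derive a b s z Hs).
      - exact (in_itv_between a b u0 v z Hu0 Hv Hz).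
      - exact (HD z Hz). }
    split; symmetry; apply null_derivative_const; intros z Hz.
    - apply Hd; lra.
    - apply (ex_derive_continuous (Sfun s) z). exists 0. apply Hd, Hz.
    - apply Hd; lra.
    - apply (ex_derive_continuous (Pfun s) z). exists 0. apply Hd, Hz. }
  assert (HD : forall u, in_itv a b u -> Dfun s u <> 0).
  { intros u Hu. apply (segment_nonzero (Dfun s) u0 u).
    - intros z Hz. exact (Hcont z (in_itv_between a b u0 u z Hu0 Hu Hz)).
    - intros z Hz Hbefore.
      pose proof (in_itv_between a b u0 u z Hu0 Hu Hz) as Hzi.
      set (A := Sfun s u0).
      (* Integrating factor for D' = A D. This holds only before [z], where D is already known to be
         nonzero; continuity of [F] carries its value to [z] itself. *)
      set (F := fun x => Dfun s x * exp (- A * (x - u0))).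
      assert (HF : F u0 = F z).
      { apply null_derivative_const; intros w Hw.
        - assert (Hwi : in_itv a b w)
            by (apply (in_itv_between a b u0 z w Hu0 Hzi); lra).
          (* [w] lies strictly before [z], so no point between [u0] and [w] equals [z] and [Hbefore]
             applies to all of them. *)
          assert (Hsub : forall x, Rmin u0 w <= x <= Rmax u0 w ->
                    Dfun s x <> 0).
          { intros x Hx. revert Hw Hx. unfold Rmin, Rmax.
            destruct (Rle_dec u0 z), (Rle_dec u0 w); intros Hw Hx;
              try lra; apply Hbefore; try lra;
              unfold Rmin, Rmax; destruct (Rle_dec u0 z); lra. }
          pose proof (proj1 (HSP w Hwi Hsub)) as HSw. fold A in HSw.
          assert (HDw : Dfun s w <> 0).
          { apply Hsub. unfold Rmin, Rmax. destruct (Rle_dec u0 w); lra. }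
          pose proof (Dfun_derive a b s w Hs Hwi) as Hd.
          replace (Derive_n s 1 w * Derive_n s 2 w - s w * Derive_n s 3 w)
            with (A * Dfun s w) in Hd.
          2:{ rewrite <- HSw. unfold Sfun, S_of. fold (Dfun s w).
              field. exact HDw. }
          unfold F. auto_derive.
          + exists (A * Dfun s w). exact Hd.
          + rewrite (Derive_eta _ _ _ Hd). ring.
        - apply (continuous_mult (Dfun s) (fun x => exp (- A * (x - u0)))).
          + exact (Hcont w (in_itv_between a b u0 z w Hu0 Hzi Hw)).
          + apply (ex_derive_continuous (fun x => exp (- A * (x - u0))) w).
            auto_derive. exact I. }
      intro Hz0. apply HD0. unfold F in HF.
      rewrite Hz0, Rmult_0_l, Rminus_diag, Rmult_0_r, exp_0, Rmult_1_r in HF.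
      exact HF. }
  intros u Hu. split; [exact (HD u Hu)|].
  apply HSP; [exact Hu|]. intros z Hz.
  exact (HD z (in_itv_between a b u0 u z Hu0 Hu Hz)).
Qed.

(** * Reduction to the second-order linear equation *)

Lemma S_P_relation (x0 x1 x2 x3 : R) :
  D_of x0 x1 x2 <> 0 ->
  x2 = S_of x0 x1 x2 x3 * x1 - P_of x0 x1 x2 x3 * x0.
Proof. intro HD. unfold S_of, P_of, D_of in *. field. exact HD. Qed.

(** Cramer's rule: S and P are the solution of the 2 by 2 system formed by this relation and the
    previous one, whose determinant is -D. *)
Lemma S_P_relation_next (x0 x1 x2 x3 : R) :
  D_of x0 x1 x2 <> 0 ->
  x3 = S_of x0 x1 x2 x3 * x2 - P_of x0 x1 x2 x3 * x1.
Proof. intro HD. unfold S_of, P_of, D_of in *. field. exact HD. Qed.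

(** The equation f'' - A f' + B f = 0 as a first-order system on the whole line. Carrying the
    derivative [g] explicitly records differentiability together with its value. *)
Definition lin_sol (A B : R) (f g : R -> R) : Prop :=
  forall u, is_derive f u (g u) /\ is_derive g u (A * g u - B * f u).

(** With constant coefficients the equation is preserved by differentiation; the inductions on the
    order of derivatives below pass from [f] to [g] in this way. *)
Lemma lin_sol_derive (A B : R) (f g : R -> R) :
  lin_sol A B f g -> lin_sol A B g (fun u => A * g u - B * f u).
Proof.
  intros H u. destruct (H u) as [Hf Hg]. split; [exact Hg|].
  auto_derive.
  - repeat split; eexists; eassumption.
  - rewrite (Derive_eta _ _ _ Hf), (Derive_eta _ _ _ Hg). ring.
Qed.

Lemma lin_sol_Derive_n (A B : R) (f g : R -> R) (k : nat) :
  lin_sol A B f g -> forall u, ex_derive_n f k u /\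
    Derive_n f (S k) u = Derive_n g k u.
Proof.
  intros H.
  assert (E : forall k u, Derive_n f (S k) u = Derive_n g k u).
  (* [Derive_n] adds derivatives on the outside; composing moves one of them to the inside, where it
     turns [f] into [g]. *)
  { intros j u. rewrite <- Nat.add_1_r, <- Derive_n_comp.
    apply Derive_n_ext. intro v. apply is_derive_unique, H. }
  intro u. split; [|apply E].
  revert f g H u E. induction k as [|k IH]; intros f g H u E; [exact I|].
  destruct k as [|k].
  - simpl. eexists. apply H.
  - change (ex_derive (Derive_n f (S k)) u).
    apply ex_derive_ext with (Derive_n g k).
    { intro t. symmetry. apply E. }
    change (ex_derive_n g (S k) u).
    apply (IH g _ (lin_sol_derive A B f g H)).
    intros j v. rewrite <- Nat.add_1_r, <- Derive_n_comp.
    apply Derive_n_ext. intro w. apply is_derive_unique, H.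
Qed.

Lemma lin_sol_recurrence (A B : R) (f g : R -> R) (k : nat) (u : R) :
  lin_sol A B f g ->
  Derive_n f (S (S k)) u = A * Derive_n f (S k) u - B * Derive_n f k u.
Proof.
  revert f g. induction k as [|k IH]; intros f g H.
  - rewrite !(proj2 (lin_sol_Derive_n A B f g _ H u)).
    apply is_derive_unique, H.
  - rewrite !(proj2 (lin_sol_Derive_n A B f g _ H u)).
    exact (IH g _ (lin_sol_derive A B f g H)).
Qed.

(** The left-hand side of the fourth-order equation is minus the 3 by 3 Hankel determinant of s0,
    ..., s4, and the recurrence makes its columns linearly dependent. *)
Lemma lin_sol_solution (a b : Rbar) (A B : R) (f g : R -> R) :
  lin_sol A B f g -> solution_on a b f.
Proof.
  intros H u _. split.
  - intros k _. apply (lin_sol_Derive_n A B f g k H u).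
  - unfold ode_at. cbv zeta.
    rewrite (lin_sol_recurrence A B f g 2 u H),
      (lin_sol_recurrence A B f g 1 u H), (lin_sol_recurrence A B f g 0 u H).
    simpl (Derive_n f 0 u). ring.
Qed.

(** For these coefficients the recurrence forces the second and third derivatives at [u0] to be [s2]
    and [s3], so two of the four conditions suffice. *)
Lemma lin_sol_init_cond (u0 s0 s1 s2 s3 : R) (f g : R -> R) :
  D_of s0 s1 s2 <> 0 ->
  lin_sol (S_of s0 s1 s2 s3) (P_of s0 s1 s2 s3) f g ->
  init_cond u0 s0 s1 s2 s3 f <-> f u0 = s0 /\ g u0 = s1.
Proof.
  intros HD H.
  assert (E1 : Derive_n f 1 u0 = g u0) by apply (lin_sol_Derive_n _ _ f g 0 H).
  unfold init_cond. split.
  - intros [H0 [H1 _]]. split; congruence.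
  - intros [H0 H1].
    rewrite (lin_sol_recurrence _ _ f g 1 u0 H),
      (lin_sol_recurrence _ _ f g 0 u0 H).
    simpl (Derive_n f 0 u0). rewrite E1, H0, H1.
    rewrite <- (S_P_relation s0 s1 s2 s3 HD).
    rewrite <- (S_P_relation_next s0 s1 s2 s3 HD).
    repeat split; reflexivity.
Qed.

(** * Explicit solutions, and uniqueness for the linear equation *)

Lemma form_exp_lin_sol (p0 p1 p2 p3 : R) :
  lin_sol (p1 + p3) (p1 * p3)
    (form_exp p0 p1 p2 p3) (form_exp (p0 * p1) p1 (p2 * p3) p3).
Proof.
  intro u. unfold form_exp. split; auto_derive; try exact I; ring.
Qed.

Lemma form_lin_lin_sol (a0 a1 a2 : R) :
  lin_sol (2 * a2) (a2 ^ 2)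
    (form_lin a0 a1 a2) (form_lin (a1 + a0 * a2) (a1 * a2) a2).
Proof.
  intro u. unfold form_lin. split; auto_derive; try exact I; ring.
Qed.

Lemma form_sin_lin_sol (b0 b1 b2 b3 : R) :
  lin_sol (2 * b1) (b1 ^ 2 + b2 ^ 2) (form_sin b0 b1 b2 b3)
    (fun u => b0 * exp (b1 * u)
                * (b1 * sin (b2 * u + b3) + b2 * cos (b2 * u + b3))).
Proof.
  intro u. unfold form_sin. split; auto_derive; try exact I; ring.
Qed.

Lemma sqrt_disc_exp (A B : R) : A ^ 2 - 4 * B > 0 ->
  exists p1 p3, p1 < p3 /\ A = p1 + p3 /\ B = p1 * p3.
Proof.
  intro H. set (r := sqrt (A ^ 2 - 4 * B)).
  assert (Hr : 0 < r) by (apply sqrt_lt_R0; lra).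
  assert (Hr2 : r * r = A ^ 2 - 4 * B) by (apply sqrt_sqrt; lra).
  exists ((A - r) / 2), ((A + r) / 2). repeat split; lra.
Qed.

Lemma sqrt_disc_sin (A B : R) : A ^ 2 - 4 * B < 0 ->
  exists b1 b2, 0 < b2 /\ A = 2 * b1 /\ B = b1 ^ 2 + b2 ^ 2.
Proof.
  intro H. set (r := sqrt (4 * B - A ^ 2)).
  assert (Hr : 0 < r) by (apply sqrt_lt_R0; lra).
  assert (Hr2 : r * r = 4 * B - A ^ 2) by (apply sqrt_sqrt; lra).
  exists (A / 2), (r / 2). repeat split; lra.
Qed.

(** The solution with value 0 and slope 1 at the origin; its translates and their derivatives give
    every other solution, hence both existence and uniqueness. The sign of the discriminant selects
    the explicit form. *)
Lemma fundamental_solution (A B : R) :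
  exists f g, lin_sol A B f g /\ f 0 = 0 /\ g 0 = 1.
Proof.
  destruct (Rtotal_order (A ^ 2 - 4 * B) 0) as [H|[H|H]].
  - destruct (sqrt_disc_sin A B H) as [b1 [b2 [Hb [-> ->]]]].
    eexists _, _. split; [exact (form_sin_lin_sol (/ b2) b1 b2 0)|].
    unfold form_sin. rewrite !Rmult_0_r, Rplus_0_l, exp_0, sin_0, cos_0.
    split; field; lra.
  - replace A with (2 * (A / 2)) by field.
    replace B with ((A / 2) ^ 2) by lra.
    eexists _, _. split; [exact (form_lin_lin_sol 0 1 (A / 2))|].
    unfold form_lin. rewrite !Rmult_0_r, exp_0. split; ring.
  - destruct (sqrt_disc_exp A B H) as [p1 [p3 [Hp [-> ->]]]].
    eexists _, _.
    split; [exact (form_exp_lin_sol (- / (p3 - p1)) p1 (/ (p3 - p1)) p3)|].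
    unfold form_exp. rewrite !Rmult_0_r, exp_0. split; field; lra.
Qed.

(** For fixed [v], the quantity [K u] of the proof is constant in [u], and it
    equals [f v] at [u = v]. *)
Lemma lin_representation (a b : Rbar) (A B u0 v : R) (f g phi psi : R -> R) :
  lin_sol A B phi psi -> phi 0 = 0 -> psi 0 = 1 ->
  in_itv a b u0 -> in_itv a b v ->
  (forall u, in_itv a b u ->
     is_derive f u (g u) /\ is_derive g u (A * g u - B * f u)) ->
  f v = g u0 * phi (v - u0) + f u0 * (psi (v - u0) - A * phi (v - u0)).
Proof.
  intros Hphi Hphi0 Hpsi0 Hu0 Hv Hf.
  set (K := fun u => g u * phi (v - u) + f u * (psi (v - u) - A * phi (v - u))).
  change (f v = K u0). rewrite (null_derivative_const_itv a b K u0 v Hu0 Hv).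
  { unfold K. rewrite Rminus_diag, Hphi0, Hpsi0. ring. }
  intros z Hz. destruct (Hf z Hz) as [H1 H2].
  destruct (Hphi (v - z)) as [H3 H4].
  unfold K. auto_derive.
  - repeat split; eexists; eassumption.
  - rewrite (Derive_eta _ _ _ H1), (Derive_eta _ _ _ H2).
    change (v + - z) with (v - z).
    rewrite (Derive_eta _ _ _ H3), (Derive_eta _ _ _ H4). ring.
Qed.

(** [f] is asked to solve the equation only inside the interval, since it will be an arbitrary
    solution of the fourth-order equation there. Both functions have the same representation by
    their data at [u0]. *)
Lemma lin_sol_unique (a b : Rbar) (A B u0 : R) (f g h k : R -> R) :
  in_itv a b u0 ->
  (forall u, in_itv a b u ->
     is_derive f u (g u) /\ is_derive g u (A * g u - B * f u)) ->
  lin_sol A B h k -> f u0 = h u0 -> g u0 = k u0 ->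
  forall v, in_itv a b v -> f v = h v.
Proof.
  intros Hu0 Hf Hh E0 E1 v Hv.
  destruct (fundamental_solution A B) as [phi [psi [Hl [Hphi Hpsi]]]].
  rewrite (lin_representation a b A B u0 v f g phi psi Hl Hphi Hpsi Hu0 Hv Hf).
  rewrite (lin_representation a b A B u0 v h k phi psi Hl Hphi Hpsi Hu0 Hv
             (fun u _ => Hh u)).
  rewrite E0, E1. reflexivity.
Qed.

(** * The initial value problem of the fourth-order equation *)

Lemma ivp_invariants (a b : Rbar) (u0 s0 s1 s2 s3 : R) (s : R -> R) :
  D_of s0 s1 s2 <> 0 -> in_itv a b u0 ->
  ivp_solution a b u0 s0 s1 s2 s3 s ->
  forall u, in_itv a b u ->
    Dfun s u <> 0 /\ Sfun s u = S_of s0 s1 s2 s3 /\ Pfun s u = P_of s0 s1 s2 s3.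
Proof.
  intros HD Hu0 [Hs [H0 [H1 [H2 H3]]]] u Hu.
  pose proof (solution_invariants a b s u0 Hu0 Hs) as H.
  (* Only the occurrences at [u0] are unfolded, to receive the initial data. *)
  unfold Dfun at 1, Sfun at 2, Pfun at 2 in H.
  rewrite H0, H1, H2, H3 in H. exact (H HD u Hu).
Qed.

(** The invariants turn [s] into a solution of the linear equation. Comparison with a global linear
    solution [f] yields uniqueness as well as each of the three closed forms. *)
Lemma ivp_unique (a b : Rbar) (u0 s0 s1 s2 s3 : R) (s f g : R -> R) :
  D_of s0 s1 s2 <> 0 -> in_itv a b u0 ->
  ivp_solution a b u0 s0 s1 s2 s3 s ->
  lin_sol (S_of s0 s1 s2 s3) (P_of s0 s1 s2 s3) f g ->
  init_cond u0 s0 s1 s2 s3 f ->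
  forall u, in_itv a b u -> s u = f u.
Proof.
  intros HD Hu0 Hsol Hf Hfi.
  apply (lin_sol_init_cond u0 s0 s1 s2 s3 f g HD Hf) in Hfi.
  destruct Hfi as [Hf0 Hf1].
  pose proof (ivp_invariants a b u0 s0 s1 s2 s3 s HD Hu0 Hsol) as Hinv.
  destruct Hsol as [Hs [H0 [H1 _]]].
  apply (lin_sol_unique a b (S_of s0 s1 s2 s3) (P_of s0 s1 s2 s3) u0
           s (Derive_n s 1) f g Hu0); try assumption; try congruence.
  intros u Hu. split.
  - exact (solution_derivatives a b s u 0 Hs Hu ltac:(lia)).
  - destruct (Hinv u Hu) as [HDu [<- <-]].
    unfold Sfun, Pfun. rewrite <- S_P_relation by exact HDu.
    exact (solution_derivatives a b s u 1 Hs Hu ltac:(lia)).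
Qed.

Lemma lin_ivp_exists (A B u0 x y : R) :
  exists f g, lin_sol A B f g /\ f u0 = x /\ g u0 = y.
Proof.
  destruct (fundamental_solution A B) as [phi [psi [H [H0 H1]]]].
  (* [psi - A * phi] is the solution with value 1 and slope 0 at the origin; its derivative is
     [- B * phi]. *)
  exists (fun u => y * phi (u - u0) + x * (psi (u - u0) - A * phi (u - u0))),
    (fun u => y * psi (u - u0) + x * (- B * phi (u - u0))).
  rewrite !Rminus_diag, H0, H1. split; [|split; ring].
  intro u. destruct (H (u - u0)) as [Hphi Hpsi].
  split; auto_derive; try (repeat split; eexists; eassumption);
    change (u + - u0) with (u - u0);
    rewrite ?(Derive_eta _ _ _ Hphi), ?(Derive_eta _ _ _ Hpsi); ring.
Qed.

(** * Characteristic roots and polar coordinates *)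

Lemma roots_are_of_vieta (A B : R) (z1 z2 : C) :
  RtoC A = (z1 + z2)%C -> RtoC B = (z1 * z2)%C -> roots_are A B z1 z2.
Proof.
  intros HA HB z. rewrite HA, HB.
  replace (z * z - (z1 + z2) * z + z1 * z2)%C with ((z - z1) * (z - z2))%C
    by ring.
  split.
  - intro H. destruct (Ceq_dec (z - z1)%C 0) as [H1|H1];
      [left|destruct (Ceq_dec (z - z2)%C 0) as [H2|H2]; [right|]].
    + replace z with ((z - z1) + z1)%C by ring. rewrite H1. ring.
    + replace z with ((z - z2) + z2)%C by ring. rewrite H2. ring.
    + exfalso. exact (Cmult_neq_0 _ _ H1 H2 H).
  - intros [-> | ->]; ring.
Qed.

Lemma polar_exists (x y : R) : x <> 0 \/ y <> 0 ->
  exists r t, 0 < r /\ r * sin t = x /\ r * cos t = y.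
Proof.
  intro H. set (r := sqrt (x ^ 2 + y ^ 2)).
  assert (Hpos : 0 < x ^ 2 + y ^ 2) by (destruct H; nra).
  assert (Hr : 0 < r) by (apply sqrt_lt_R0; exact Hpos).
  assert (Hr2 : r * r = x ^ 2 + y ^ 2) by (apply sqrt_sqrt; lra).
  assert (Hy : y = r * (y / r)) by (field; lra).
  set (c := y / r) in *.
  assert (Hx2 : r * r * (1 - c * c) = x ^ 2).
  { transitivity (r * r - (r * c) ^ 2); [ring|]. rewrite <- Hy, Hr2. ring. }
  assert (Hc2 : 0 <= 1 - c * c).
  { apply (Rmult_le_reg_l (r * r)); nra. }
  assert (Hc : -1 <= c <= 1) by (split; nra).
  assert (Hs : r * sqrt (1 - c²) = Rabs x).
  { rewrite <- (sqrt_Rsqr_abs x), <- (sqrt_Rsqr r) at 1 by lra.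
    rewrite <- sqrt_mult by (unfold Rsqr; nra).
    f_equal. unfold Rsqr. lra. }
  (* The sine of [acos c] is nonnegative, so a negative [x] requires the opposite angle. *)
  destruct (Rle_or_lt 0 x) as [Hx|Hx].
  - exists r, (acos c). rewrite sin_acos, cos_acos by exact Hc.
    rewrite Hs, (Rabs_pos_eq x Hx). auto.
  - exists r, (- acos c). rewrite sin_neg, cos_neg, sin_acos, cos_acos by exact Hc.
    rewrite Ropp_mult_distr_r_reverse, Hs, (Rabs_left x Hx). repeat split; lra.
Qed.

Lemma polar_unique (r r' t t' : R) : 0 < r -> 0 < r' ->
  (r' * sin t' = r * sin t /\ r' * cos t' = r * cos t <->
   r' = r /\ exists k : Z, t' = t + 2 * PI * IZR k).
Proof.
  intros Hr Hr'. split.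
  - intros [Hs Hc].
    pose proof (sin2_cos2 t) as E. pose proof (sin2_cos2 t') as E'.
    unfold Rsqr in E, E'.
    assert (Hrr : r' = r).
    { assert (r' * r' = r * r).
      { replace (r * r) with ((r * sin t) * (r * sin t) + (r * cos t) * (r * cos t))
          by (transitivity (r * r * (sin t * sin t + cos t * cos t));
              [ring|rewrite E; ring]).
        rewrite <- Hs, <- Hc.
        transitivity (r' * r' * (sin t' * sin t' + cos t' * cos t'));
          [rewrite E'; ring|ring]. }
      nra. }
    split; [exact Hrr|]. subst r'.
    apply Rmult_eq_reg_l in Hs, Hc; [|lra|lra].
    (* The angles differ by one of cosine 1. Passing to half of the difference gives a zero of the
       sine, hence a multiple of pi, and so a multiple of 2 pi for the difference. *)
    assert (Hsin : sin ((t' - t) / 2) = 0).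
    { assert (Hcos : cos (2 * ((t' - t) / 2)) = 1).
      { replace (2 * ((t' - t) / 2)) with (t' - t) by field.
        rewrite cos_minus, Hs, Hc. lra. }
      rewrite cos_2a_sin in Hcos. nra. }
    apply sin_eq_0_0 in Hsin. destruct Hsin as [k Hk]. exists k. lra.
  - intros [-> [k ->]].
    assert (Hsin : sin (IZR k * PI) = 0)
      by (apply sin_eq_0_1; exists k; reflexivity).
    replace (2 * PI * IZR k) with (2 * (IZR k * PI)) by ring.
    rewrite sin_plus, cos_plus, sin_2a, cos_2a_sin, Hsin. split; ring.
Qed.

(** * Classification by the sign of the discriminant *)

Theorem theorem2 (u0 s0 s1 s2 s3 : R)
  (hs1 : s1 <> 0) (hD : s1 ^ 2 - s0 * s2 <> 0) :
  let Su0 := S_of s0 s1 s2 s3 in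
  let Pu0 := P_of s0 s1 s2 s3 in
  let Delta := Su0 ^ 2 - 4 * Pu0 in
  (* S and P are well defined and constant along any solution, which
     satisfies the second-order linear equation *)
  (forall (a b : Rbar) (s : R -> R), in_itv a b u0 ->
     ivp_solution a b u0 s0 s1 s2 s3 s ->
     forall u : R, in_itv a b u ->
       Dfun s u <> 0 /\ Sfun s u = Su0 /\ Pfun s u = Pu0 /\
       Derive_n s 2 u - Sfun s u * Derive_n s 1 u + Pfun s u * s u = 0)
  /\
  (* existence and uniqueness *)
  (forall a b : Rbar, in_itv a b u0 ->
     (exists s : R -> R, ivp_solution a b u0 s0 s1 s2 s3 s) /\
     (forall s t : R -> R,
        ivp_solution a b u0 s0 s1 s2 s3 s ->
        ivp_solution a b u0 s0 s1 s2 s3 t ->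
        forall u : R, in_itv a b u -> s u = t u))
  /\
  (Delta > 0 ->
     exists p1 p3 : R, p3 > p1 /\ roots_are Su0 Pu0 (RtoC p1) (RtoC p3) /\
     exists p0 p2 : R, p0 * p2 * (p1 - p3) <> 0 /\
       (forall q0 q2 : R,
          init_cond u0 s0 s1 s2 s3 (form_exp q0 p1 q2 p3) <->
          q0 = p0 /\ q2 = p2) /\
       (forall (a b : Rbar) (s : R -> R), in_itv a b u0 ->
          ivp_solution a b u0 s0 s1 s2 s3 s ->
          forall u : R, in_itv a b u -> s u = form_exp p0 p1 p2 p3 u))
  /\
  (Delta = 0 ->
     exists a0 a1 a2 : R, a1 <> 0 /\ a2 = Su0 / 2 /\
       (forall c0 c1 : R,
          init_cond u0 s0 s1 s2 s3 (form_lin c0 c1 a2) <->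
          c0 = a0 /\ c1 = a1) /\
       (forall (a b : Rbar) (s : R -> R), in_itv a b u0 ->
          ivp_solution a b u0 s0 s1 s2 s3 s ->
          forall u : R, in_itv a b u -> s u = form_lin a0 a1 a2 u))
  /\
  (Delta < 0 ->
     exists b1 b2 : R, b2 > 0 /\
       roots_are Su0 Pu0 (RtoC b1 + Ci * RtoC b2)%C (RtoC b1 - Ci * RtoC b2)%C /\
     exists b0 b3 : R, b0 > 0 /\
       (forall c0 c3 : R, c0 > 0 ->
          (init_cond u0 s0 s1 s2 s3 (form_sin c0 b1 b2 c3) <->
           c0 = b0 /\ exists k : Z, c3 = b3 + 2 * PI * IZR k)) /\
       (forall (a b : Rbar) (s : R -> R), in_itv a b u0 ->
          ivp_solution a b u0 s0 s1 s2 s3 s ->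
          forall u : R, in_itv a b u -> s u = form_sin b0 b1 b2 b3 u)).
Proof.
  intros Su0 Pu0 Delta.
  assert (HD : D_of s0 s1 s2 <> 0) by exact hD.
  pose proof (S_P_relation s0 s1 s2 s3 HD) as Hs2.
  fold Su0 Pu0 in Hs2.
  (* This is D with [s2] eliminated. For real roots it factors as (s1 - p1 s0)(s1 - p3 s0), which
     makes the leading coefficients nonzero in the first two cases. *)
  assert (HD' : s1 ^ 2 - Su0 * s0 * s1 + Pu0 * s0 ^ 2 <> 0).
  { intro H. apply hD. rewrite Hs2. rewrite <- H. ring. }
  split; [|split; [|split; [|split]]].
  - intros a b s Hu0 Hs u Hu.
    destruct (ivp_invariants a b u0 s0 s1 s2 s3 s HD Hu0 Hs u Hu)
      as [HDu [HSu HPu]].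
    repeat split; try assumption.
    pose proof (S_P_relation _ _ _ (Derive_n s 3 u) HDu) as H.
    fold (Sfun s u) (Pfun s u) in H. lra.
  - intros a b Hu0.
    destruct (lin_ivp_exists Su0 Pu0 u0 s0 s1) as [f [g [Hf [Hf0 Hf1]]]].
    assert (Hi : init_cond u0 s0 s1 s2 s3 f)
      by (apply (lin_sol_init_cond u0 s0 s1 s2 s3 f g HD Hf); auto).
    split.
    + exists f. split; [exact (lin_sol_solution a b _ _ f g Hf)|exact Hi].
    + intros s t Hs Ht u Hu.
      rewrite (ivp_unique a b u0 s0 s1 s2 s3 s f g HD Hu0 Hs Hf Hi u Hu).
      rewrite (ivp_unique a b u0 s0 s1 s2 s3 t f g HD Hu0 Ht Hf Hi u Hu).
      reflexivity.
  - intro HDelta.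
    destruct (sqrt_disc_exp Su0 Pu0 HDelta) as [p1 [p3 [Hp [HS HP]]]].
    exists p1, p3. split; [exact Hp|]. split.
    { apply roots_are_of_vieta; [rewrite HS; apply RtoC_plus|].
      rewrite HP. apply RtoC_mult. }
    assert (Hsol : forall q0 q2, lin_sol Su0 Pu0
              (form_exp q0 p1 q2 p3) (form_exp (q0 * p1) p1 (q2 * p3) p3)).
    { intros q0 q2. rewrite HS, HP. apply form_exp_lin_sol. }
    pose proof (exp_pos (p1 * u0)) as HE1. pose proof (exp_pos (p3 * u0)) as HE3.
    (* [p0] and [p2] solve the linear system given by the value and the slope at [u0]. *)
    set (p0 := (p3 * s0 - s1) / ((p3 - p1) * exp (p1 * u0))).
    set (p2 := (s1 - p1 * s0) / ((p3 - p1) * exp (p3 * u0))).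
    assert (Hi : forall q0 q2,
              init_cond u0 s0 s1 s2 s3 (form_exp q0 p1 q2 p3) <->
              q0 = p0 /\ q2 = p2).
    { intros q0 q2.
      rewrite (lin_sol_init_cond u0 s0 s1 s2 s3 _ _ HD (Hsol q0 q2)).
      unfold form_exp, p0, p2. split.
      - intros [H0 H1]. rewrite <- H0, <- H1. split; field; lra.
      - intros [-> ->]. split; field; lra. }
    exists p0, p2. split; [|split; [exact Hi|]].
    + intro H0. apply HD'.
      transitivity (p0 * p2 * (p1 - p3) * (exp (p1 * u0) * exp (p3 * u0)
                      * (p3 - p1))).
      * rewrite HS, HP. unfold p0, p2. field. lra.
      * rewrite H0. ring.
    + intros a b s Hu0 Hs.
      apply (ivp_unique a b u0 s0 s1 s2 s3 s _ _ HD Hu0 Hs (Hsol p0 p2)).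
      apply Hi. auto.
  - intro HDelta.
    set (a2 := Su0 / 2).
    assert (HS : Su0 = 2 * a2) by (unfold a2; field).
    assert (HP : Pu0 = a2 ^ 2) by (unfold Delta in HDelta; unfold a2; lra).
    assert (Hsol : forall c0 c1, lin_sol Su0 Pu0
              (form_lin c0 c1 a2) (form_lin (c1 + c0 * a2) (c1 * a2) a2)).
    { intros c0 c1. rewrite HS, HP. apply form_lin_lin_sol. }
    pose proof (exp_pos (a2 * u0)) as HE.
    set (a1 := (s1 - a2 * s0) / exp (a2 * u0)).
    set (a0 := s0 / exp (a2 * u0) - a1 * u0).
    assert (Hi : forall c0 c1,
              init_cond u0 s0 s1 s2 s3 (form_lin c0 c1 a2) <->
              c0 = a0 /\ c1 = a1).
    { intros c0 c1.
      rewrite (lin_sol_init_cond u0 s0 s1 s2 s3 _ _ HD (Hsol c0 c1)).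
      unfold form_lin, a0, a1. split.
      - intros [H0 H1]. rewrite <- H0, <- H1. split; field; lra.
      - intros [-> ->]. split; field; lra. }
    exists a0, a1, a2. split; [|split; [reflexivity|split; [exact Hi|]]].
    + intro H0. apply HD'.
      (* With a double root D is the square of s1 - a2 s0. *)
      transitivity ((a1 * exp (a2 * u0)) ^ 2).
      * rewrite HS, HP. unfold a1. field. lra.
      * rewrite H0. ring.
    + intros a b s Hu0 Hs.
      apply (ivp_unique a b u0 s0 s1 s2 s3 s _ _ HD Hu0 Hs (Hsol a0 a1)).
      apply Hi. auto.
  - intro HDelta.
    destruct (sqrt_disc_sin Su0 Pu0 HDelta) as [b1 [b2 [Hb [HS HP]]]].
    exists b1, b2. split; [exact Hb|]. split.
    { apply roots_are_of_vieta; rewrite ?HS, ?HP;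
        apply injective_projections; simpl; ring. }
    assert (Hsol : forall c0 c3, lin_sol Su0 Pu0 (form_sin c0 b1 b2 c3)
              (fun u => c0 * exp (b1 * u)
                 * (b1 * sin (b2 * u + c3) + b2 * cos (b2 * u + c3)))).
    { intros c0 c3. rewrite HS, HP. apply form_sin_lin_sol. }
    pose proof (exp_pos (b1 * u0)) as HE.
    (* The value and slope of the form at [u0] prescribe b0 exp(b1 u0) times the sine and cosine of
       b2 u0 + b3; these products are the two coordinates here. If [s0 = 0], the second is s1 / b2,
       nonzero by [hs1]. *)
    destruct (polar_exists s0 ((s1 - b1 * s0) / b2)) as [r [t [Hr [Hsin Hcos]]]].
    { destruct (Req_dec s0 0) as [Hs0|Hs0]; [right|left; exact Hs0].
      rewrite Hs0, Rmult_0_r, Rminus_0_r. apply Rmult_integral_contrapositive.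
      split; [exact hs1|]. apply Rinv_neq_0_compat. lra. }
    set (b0 := r / exp (b1 * u0)).
    set (b3 := t - b2 * u0).
    assert (Hb0 : b0 > 0) by (apply Rdiv_lt_0_compat; assumption).
    assert (Hi : forall c0 c3, c0 > 0 ->
              (init_cond u0 s0 s1 s2 s3 (form_sin c0 b1 b2 c3) <->
               c0 = b0 /\ exists k : Z, c3 = b3 + 2 * PI * IZR k)).
    { intros c0 c3 Hc0.
      rewrite (lin_sol_init_cond u0 s0 s1 s2 s3 _ _ HD (Hsol c0 c3)).
      unfold form_sin.
      transitivity (c0 * exp (b1 * u0) * sin (b2 * u0 + c3) = r * sin t /\
                    c0 * exp (b1 * u0) * cos (b2 * u0 + c3) = r * cos t).
      { rewrite Hsin, Hcos. split; intros [H1 H2]; split; try exact H1.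
        - rewrite <- H2, <- H1. field. lra.
        - transitivity (b1 * (c0 * exp (b1 * u0) * sin (b2 * u0 + c3))
                        + b2 * (c0 * exp (b1 * u0) * cos (b2 * u0 + c3)));
            [ring|]. rewrite H1, H2. field. lra. }
      rewrite polar_unique; [|exact Hr|apply Rmult_lt_0_compat; assumption].
      unfold b0, b3. split; intros [H1 [k H2]]; (split; [|exists k; lra]).
      - rewrite <- H1. field. lra.
      - rewrite H1. field. lra. }
    exists b0, b3. split; [exact Hb0|split; [exact Hi|]].
    intros a b s Hu0 Hs.
    apply (ivp_unique a b u0 s0 s1 s2 s3 s _ _ HD Hu0 Hs (Hsol b0 b3)).
    apply (Hi b0 b3 Hb0). split; [reflexivity|]. exists 0%Z. ring.
Qed.
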